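(* There are positive constants $a$, $A_1$, $A_2$ such that for all integers $n>2$, $$a\,S(n)\le p_n\le A_1 S(n)+A_2 n,$$ where $p_n$ denotes the $n$-th prime.
   Context: Let $\varphi$ be Euler's totient function. The height function $H$ on positive integers is defined by $H(1)=0$ and $H(n)=H(\varphi(n))+1$ for $n\ge 2$. Let $S(n)=\sum_{k=1}^n H(k)$. *)

(* Defs.v *)
From mathcomp Require Import all_boot.

Set Implicit Arguments.
Unset Strict Implicit.
Unset Printing Implicit Defensive.

(* [height_rec k n] is the height of [n] computed with [k] as a bound on the
   number of iterations of the totient; [k = n] is always enough, see
   [heightE].  The value at [n = 0] is a junk value. *)
Fixpoint height_rec (k n : nat) : nat :=
  if k is k'.+1 then
    if n <= 1 then 0 else (height_rec k' (totient n)).+1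
  else 0.

Definition height (n : nat) : nat := height_rec n n.

Lemma totient_lt (n : nat) : 1 < n -> totient n < n.
Proof.
case: n => [|[|n]] // _; rewrite totient_count_coprime big_ltn //.
rewrite /coprime gcdn0 add0n ltnS.
rewrite -[leqRHS](_ : \sum_(1 <= i < n.+2) 1 = n.+1).
  by apply: leq_sum => i _; case: eqP.
by rewrite sum_nat_const_nat muln1 subn1.
Qed.

Lemma height_rec_stable (k n : nat) : n <= k -> height_rec k n = height n.
Proof.
rewrite /height; elim/ltn_ind: n k => -[|[|n]] IHn [|k] // le_nk.
have lt_tn : totient n.+2 < n.+2 by exact: totient_lt.
have le_tk : totient n.+2 <= k by rewrite -ltnS (leq_trans lt_tn).
rewrite -[LHS]/(height_rec k (totient n.+2)).+1.
rewrite -[RHS]/(height_rec n.+1 (totient n.+2)).+1.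
by rewrite (IHn _ lt_tn _ le_tk) (IHn _ lt_tn n.+1).
Qed.

Lemma height1 : height 1 = 0.
Proof. by []. Qed.

Lemma heightE (n : nat) : 2 <= n -> height n = (height (totient n)).+1.
Proof.
case: n => [|[|n]] // n_gt1.
rewrite -[LHS]/(height_rec n.+1 (totient n.+2)).+1 height_rec_stable //.
exact: (totient_lt n_gt1).
Qed.

Definition height_sum (n : nat) : nat := \sum_(1 <= k < n.+1) height k.

Lemma ex_prime_above (m : nat) : exists p, (m < p) && prime p.
Proof. by have [p lt_mp p_pr] := prime_above m; exists p; rewrite lt_mp. Qed.

Definition next_prime (m : nat) : nat := ex_minn (ex_prime_above m).

(* The indexing is from 1: [nth_prime 1 = 2]; [nth_prime 0 = 0] is a junk
   value. *)
Definition nth_prime (n : nat) : nat := iter n next_prime 0.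

Lemma prime_nth_prime (n : nat) : 0 < n -> prime (nth_prime n).
Proof.
by case: n => // n _; rewrite /nth_prime iterS /next_prime;
  case: ex_minnP => p /andP[].
Qed.

Lemma count_nth_prime (n : nat) : count prime (iota 0 (nth_prime n).+1) = n.
Proof.
elim: n => // n IHn; rewrite /nth_prime iterS -/(nth_prime n) /next_prime.
case: ex_minnP => p /andP[lt_np p_pr] min_p.
set d := p - (nth_prime n).+1; have def_p : (nth_prime n).+1 + d = p.
  exact: subnKC.
rewrite -{1}def_p -addnS iotaD count_cat IHn add0n -[d.+1]addn1 iotaD count_cat.
rewrite def_p /= p_pr.
suff -> : count prime (iota (nth_prime n).+1 d) = 0 by rewrite addn1.
apply/eqP; rewrite -leqn0 leqNgt -has_count; apply/hasPn => q.
rewrite mem_iota def_p => /andP[lt_nq lt_qp]; apply/negP => q_pr.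
by have := min_p q; rewrite lt_nq q_pr leqNgt lt_qp => /(_ isT).
Qed.

(* Main.v *)
(** Write L for the integer part of the binary logarithm.  The totient of an even
number is at most half of it and totients are even beyond 2, so H(n) <= L(n) + 1.
In the other direction, n |-> H(n) - [n odd] is completely additive (Shapiro), with
value at a prime p > 2 equal to its value at p - 1, whence n <= 3 ^ H(n).  Therefore
S(n) has the order of n L(n).  Chebyshev's bounds, which follow from
2 ^ m <= 'C(2m, m) <= 4 ^ m and the prime factorization of 'C(2m, m), give the same
order for the n-th prime. *)
Require Import Defs.
From mathcomp Require Import all_boot all_order all_algebra.
From mathcomp Require Import reals.
From mathcomp Require Import zify.
Import Order.TTheory GRing.Theory Num.Theory.
Local Open Scope nat_scope.

(** * The size of the height *)

Lemma totient_mulp_dvd p n : prime p -> p %| n -> totient (p * n) = p * totient n.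
Proof.
move=> p_pr; have [-> | n_gt0] := posnP n.
  by rewrite muln0 (_ : totient 0 = 0) ?muln0.
have [m cpm {1 2 3}->] := pfactor_coprime p_pr n_gt0.
rewrite Gauss_dvdr // => pn; have a_gt0 : 0 < logn p n.
  by rewrite lt0n; apply: contraTneq pn => ->; rewrite dvdn1 neq_ltn prime_gt1 ?orbT.
rewrite mulnCA -expnS !totient_coprime ?coprimeXr 1?coprime_sym // !totient_pfactor //=.
by rewrite -[in RHS](prednK a_gt0) /= -[in LHS](prednK a_gt0) expnS; lia.
Qed.

Lemma totient_mulp_ndvd p n : prime p -> ~~ (p %| n) -> totient (p * n) = p.-1 * totient n.
Proof. by move=> p_pr pn; rewrite totient_coprime ?prime_coprime // totient_prime. Qed.

Lemma totient_leq n : totient n <= n.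
Proof. by case: n => [|[|n]] //; apply/ltnW/totient_lt. Qed.

(** Split off the least prime factor: n = p m. An odd p not dividing m contributes the even factor p
    - 1. Otherwise either p = 2 divides m and is itself a factor, or [totient m] is a factor and m >
    2. *)
Lemma even_totient n : 2 < n -> ~~ odd (totient n).
Proof.
elim/ltn_ind: n => n IHn n_gt2.
have p_pr : prime (pdiv n) by rewrite pdiv_prime // ltnW.
have /dvdnP [m def_n] := pdiv_dvd n; move: (pdiv n) p_pr def_n => p p_pr.
rewrite mulnC => def_n; have p_gt1 := prime_gt1 p_pr.
have m_gt0 : 0 < m by case: m def_n n_gt2 => //; rewrite muln0 => ->.
have lt_mn : m < n by rewrite def_n ltn_Pmull.
have [pm | pm] := boolP (p %| m).
  rewrite def_n totient_mulp_dvd // oddM; case: (even_prime p_pr) => [-> // | p_odd].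
  rewrite p_odd; apply: IHn => //; apply: leq_trans (dvdn_leq m_gt0 pm).
  by case: (p) p_odd p_gt1 => [|[|[]]].
rewrite def_n totient_mulp_ndvd // oddM; case: (even_prime p_pr) => [p2 | p_odd]; last first.
  by rewrite -subn1 oddB ?p_odd // ltnW.
rewrite p2 /=; apply: IHn => //; move: pm n_gt2; rewrite def_n p2.
by case: (m) => [|[|[]]].
Qed.

Lemma totient_double_leq n : totient n.*2 <= n.
Proof.
elim/ltn_ind: n => n IHn; rewrite -mul2n.
have [n2 | n_odd] := boolP (2 %| n); last first.
  by rewrite totient_mulp_ndvd // mul1n totient_leq.
rewrite totient_mulp_dvd // mul2n; rewrite dvdn2 in n2.
rewrite -[leqRHS]even_halfK // leq_double -{1}[n]even_halfK //.
have [-> // | n_gt0] := posnP n; apply: IHn; lia.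
Qed.

(** Until 2 is reached, the iterates of the totient stay even and are at least halved at each
    step. *)
Lemma height_even_leq n : 0 < n -> ~~ odd n -> height n <= trunc_log 2 n.
Proof.
elim/ltn_ind: n => n IHn n_gt0 n_even.
have n_gt1 : 1 < n by case: n n_gt0 n_even {IHn} => [|[]].
rewrite heightE // trunc_log2S // ltnS.
have le_t : totient n <= n./2 by rewrite -{1}[n]even_halfK // totient_double_leq.
have [n_gt2 | n_le2] := ltnP 2 n; last by have -> : n = 2 by lia.
apply: leq_trans _ (leq_trunc_log 2 le_t).
by apply: IHn; rewrite ?totient_lt ?totient_gt0 ?even_totient.
Qed.

(** For n > 2 a single step, which costs the extra 1, leads to an even number. *)
Lemma height_leq n : height n <= (trunc_log 2 n).+1.
Proof.
have [n_gt2 | n_le2] := ltnP 2 n; last by case: n n_le2 => [|[|[]]].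
rewrite (heightE (ltnW n_gt2)) ltnS.
apply: leq_trans _ (leq_trunc_log 2 (totient_leq n)).
by apply: height_even_leq; rewrite ?totient_gt0 ?even_totient // ltnW // ltnW.
Qed.

(* Truncated subtraction makes the value at 1 equal to 0, as additivity demands. *)
Definition evenheight n := height n - odd n.

Lemma evenheightE n : 0 < n -> evenheight n = evenheight (totient n) + ~~ odd n.
Proof.
move=> n_gt0; have [n_gt2 | n_le2] := ltnP 2 n; last by case: n n_gt0 n_le2 => [|[|[]]].
rewrite /evenheight (heightE (ltnW n_gt2)) (negbTE (even_totient _ n_gt2)).
by case: (odd n); rewrite ?subn0 ?addn1 ?subn1 ?addn0.
Qed.

(** The assumption on smaller products is the induction hypothesis of [evenheightM]; it applies
    because the totient of p n is p or p - 1 times that of n. The parity terms of [evenheightE]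
    match: if p divides n, then p n and n have the same parity; if not, at most one of p and n is
    even. *)
Lemma evenheight_prime_mul p n : prime p -> 0 < n ->
    (forall a b, 0 < a -> 0 < b -> a * b < p * n ->
       evenheight (a * b) = evenheight a + evenheight b) ->
  evenheight (p * n) = evenheight p + evenheight n.
Proof.
move=> p_pr n_gt0 IH; have p_gt1 := prime_gt1 p_pr; have p_gt0 := ltnW p_gt1.
rewrite evenheightE ?muln_gt0 ?p_gt0 // oddM [in RHS](evenheightE n) //.
have [pn | pn] := boolP (p %| n).
  have n_gt1 : 1 < n by apply: leq_trans p_gt1 (dvdn_leq _ pn).
  rewrite totient_mulp_dvd // IH ?totient_gt0 ?ltn_pmul2l ?totient_lt //.
  suff -> : odd p && odd n = odd n by rewrite addnA.
  case: (odd n) (dvdn_odd pn) => [-> // | _]; exact: andbF.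
have p1_gt0 : 0 < p.-1 by lia.
rewrite totient_mulp_ndvd // IH ?totient_gt0 //; last first.
  rewrite (leq_ltn_trans (leq_mul (leqnn _) (totient_leq n))) //.
  by rewrite ltn_pmul2r // prednK.
rewrite (evenheightE p) // (totient_prime p_pr).
have : odd p || odd n.
  by case: (even_prime p_pr) pn => [-> | ->] //; rewrite dvdn2 negbK.
by case: (odd p); case: (odd n) => //= _; rewrite ?addn0 ?addnA // addnAC.
Qed.

Lemma evenheightM m n : 0 < m -> 0 < n ->
  evenheight (m * n) = evenheight m + evenheight n.
Proof.
move: {2}(m * n) (leqnn (m * n)) => N.
elim/ltn_ind: N m n => N IHN m n le_mnN m_gt0 n_gt0.
have [m_gt1 | m_le1] := ltnP 1 m; last by rewrite (_ : m = 1) ?mul1n //; lia.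
have IH a b : 0 < a -> 0 < b -> a * b < m * n ->
    evenheight (a * b) = evenheight a + evenheight b.
  by move=> a_gt0 b_gt0 lt_ab; apply: (IHN (a * b)) => //; apply: leq_trans le_mnN.
have p_pr := pdiv_prime m_gt1; have /dvdnP [m' def_m] := pdiv_dvd m.
move: (pdiv m) p_pr def_m => p p_pr; rewrite mulnC => def_m.
have m'_gt0 : 0 < m' by case: m' def_m m_gt0 => //; rewrite muln0 => ->.
have lt_m'm : m' < m by rewrite def_m ltn_Pmull ?prime_gt1.
(* The prime case serves twice: here it detaches p from p (m' n), and below it reassembles p m' =
   m. *)
rewrite {1}def_m -mulnA evenheight_prime_mul ?muln_gt0 ?m'_gt0 //; last first.
  by rewrite mulnA -def_m.
rewrite IH ?ltn_pmul2r // def_m evenheight_prime_mul // ?addnA // -def_m.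
move=> a b a_gt0 b_gt0 lt_ab; apply: IH => //; apply: leq_trans lt_ab _.
by rewrite leq_pmulr.
Qed.

(** By additivity only primes matter. An odd prime 2 k + 1 has the value of 2 k, which is 1 more
    than that of k, and 2 k + 1 <= 3 k; this is where the base 3 comes from. *)
Lemma leq_exp3_evenheight n : 0 < n -> n <= 3 ^ evenheight n.
Proof.
elim/ltn_ind: n => n IHn n_gt0.
have [n_gt1 | n_le1] := ltnP 1 n; last by case: n n_gt0 n_le1 {IHn} => [|[]].
have [n_pr | n_npr] := boolP (prime n).
  case: (even_prime n_pr) => [-> // | n_odd].
  have def_n : n = (2 * n./2).+1 by lia.
  rewrite evenheightE // n_odd addn0 totient_prime // {2}def_n /=.
  rewrite evenheightM //; last lia.
  rewrite expnD (_ : evenheight 2 = 1) //; have := IHn n./2; lia.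
have /dvdnP [m def_n] := pdiv_dvd n; have p_pr := pdiv_prime n_gt1.
have p_lt : pdiv n < n.
  by rewrite ltn_neqAle pdiv_leq // andbT; apply: contraNneq n_npr => <-.
have m_gt0 : 0 < m by case: m def_n n_gt1 => // ->.
have lt_mn : m < n by rewrite [ltnRHS]def_n ltn_Pmulr ?prime_gt1.
rewrite def_n evenheightM ?pdiv_gt0 // expnD.
by apply: leq_mul; apply: IHn => //; rewrite pdiv_gt0.
Qed.

Lemma trunc_log_leq_height n : trunc_log 2 n <= 2 * height n.
Proof.
have [-> // | n_gt0] := posnP n.
rewrite -(@leq_exp2l 2) // expnM; apply: leq_trans (trunc_logP _ n_gt0) _ => //.
apply: leq_trans (leq_exp3_evenheight n n_gt0) _.
(* The factor 2 comes from 3 <= 2 ^ 2. *)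
apply: leq_trans (_ : 3 ^ height n <= _); first by rewrite leq_exp2l ?leq_subr.
by case: (height n) => // h; rewrite leq_exp2r.
Qed.

(** * Bounds for the sum of the heights *)

Lemma height_sum_leq n : height_sum n <= n * (trunc_log 2 n).+1.
Proof.
rewrite /height_sum big_nat_cond.
apply: leq_trans (_ : \sum_(1 <= k < n.+1) (trunc_log 2 n).+1 <= _); last first.
  by rewrite sum_nat_const_nat subn1.
rewrite [leqRHS]big_nat_cond; apply: leq_sum => k /andP[/andP[_ le_kn] _].
by apply: leq_trans (height_leq k) _; rewrite ltnS leq_trunc_log.
Qed.

(* Of k and n + 1 - k, one is at least half of n, so their logarithms add up to at
   least that of n, up to 1. *)
Lemma height_sum_geq n : n * trunc_log 2 n <= 4 * height_sum n + n.
Proof.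
have -> : 4 * height_sum n + n
    = \sum_(1 <= k < n.+1) (2 * height k + 2 * height (n.+1 - k) + 1).
  rewrite 2!big_split -!big_distrr sum_nat_const_nat subn1 muln1 /=; congr (_ + _).
  rewrite -mulnDr /height_sum.
  rewrite [X in _ = 2 * (_ + X)]big_nat_rev /=.
  rewrite [X in _ = 2 * (_ + X)](eq_big_nat _ _ (F2 := height)); first lia.
  by move=> i /andP[i_gt0 i_le]; congr height; lia.
rewrite -[n in n * _]subn0 -subSS -sum_nat_const_nat.
rewrite big_nat_cond [leqRHS]big_nat_cond; apply: leq_sum => k /andP[/andP[k_gt0 k_le] _].
have le_half m : 0 < m -> n <= m.*2 -> trunc_log 2 n <= 2 * height m + 1.
  move=> m_gt0 /(leq_trunc_log 2); rewrite trunc_log2_double //.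
  have := trunc_log_leq_height m; lia.
have [/le_half | /ltnW lt_kn] := leqP n k.*2; first by move=> /(_ k_gt0); lia.
have := le_half (n.+1 - k); lia.
Qed.

(** * Chebyshev's bounds *)

Definition prime_count x := count prime (iota 0 x.+1).

Lemma prime_countD x y : prime_count (x + y) = prime_count x + count prime (iota x.+1 y).
Proof. by rewrite /prime_count -addSn iotaD count_cat. Qed.

Lemma leq_prime_count x y : x <= y -> prime_count x <= prime_count y.
Proof. by move=> /subnKC <-; rewrite prime_countD leq_addr. Qed.

Lemma prime_count_leq x : prime_count x <= x.
Proof. by rewrite -[leqRHS](size_iota 1 x); apply: (count_size prime (iota 1 x)). Qed.

Lemma bin_leq_exp2 n m : 'C(n, m) <= 2 ^ n.
Proof.
have [le_mn | lt_nm] := leqP m n; last by rewrite bin_small.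
rewrite -[2]/(1 + 1) expnDn (bigD1 (Ordinal (le_mn : m < n.+1))) //=.
by rewrite !exp1n !muln1 leq_addr.
Qed.

Lemma central_bin_geq m : 2 ^ m <= 'C(m + m, m).
Proof.
rewrite -binomial.Vandermonde -[2]/(1 + 1) expnDn; apply: leq_sum => i _.
by rewrite !exp1n !muln1 leq_pmulr // bin_gt0 leq_subr.
Qed.

Lemma prod_pfactor x n : 0 < n -> (forall p, x < p -> logn p n = 0) ->
  n = \prod_(p <- iota 0 x.+1 | prime p) p ^ logn p n.
Proof.
move=> n_gt0 log0; rewrite -{1}[n]partnT //.
(* Since x and n are not compared, the product is first widened to x + n, then cut at x. *)
rewrite (widen_partn _ (leq_addl x n)).
rewrite (big_cat_nat _ (_ : x.+1 <= _)) //= ?ltnS ?leq_addr //.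
rewrite [X in _ * X]big_nat_cond [X in _ * X]big1 ?muln1; last first.
  by move=> p /andP[/andP[lt_xp _] _]; rewrite log0.
rewrite /index_iota subn0 [RHS]big_mkcond; apply: eq_bigr => p _ /=.
by case: ifPn => // p_npr; rewrite lognE (negbTE p_npr).
Qed.

Lemma logn_fact_small p n : prime p -> n < p -> logn p n`! = 0.
Proof.
move=> p_pr lt_np; rewrite logn_fact // big_nat_cond big1 // => k /andP[/andP[k_gt0 _] _].
by rewrite divn_small // (leq_trans lt_np) // -{1}[p]expn1 leq_exp2l // prime_gt1.
Qed.

(** Legendre's formula padded with zero terms, so that the sums for m! and (2m)! share one range. *)
Lemma logn_fact_widen p m n : prime p -> m <= n ->
  logn p m`! = \sum_(1 <= k < n.+1) m %/ p ^ k.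
Proof.
move=> p_pr le_mn; rewrite logn_fact // [RHS](big_cat_nat _ (_ : m.+1 <= _)) //=.
rewrite [X in _ = _ + X]big_nat_cond [X in _ + X]big1 ?addn0 // => k /andP[/andP[lt_mk _] _].
by rewrite divn_small // (ltn_trans lt_mk) // ltn_expl // prime_gt1.
Qed.

Lemma logn_central_bin p m :
  logn p (m + m)`! = logn p 'C(m + m, m) + (logn p m`!).*2.
Proof.
rewrite -(bin_fact (leq_addl m m)) addnK !lognM ?muln_gt0 ?fact_gt0 ?bin_gt0 ?leq_addl //.
by rewrite -addnn.
Qed.

(** By Legendre's formula the exponent is the sum over k of floor(2m / p^k) - 2 floor(m / p^k). Each
    term is 0 or 1, and it is 0 once p^k > 2m, so the exponent is at most t. *)
Lemma pfactor_central_bin p m : prime p -> 0 < m ->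
  p ^ logn p 'C(m + m, m) <= m + m.
Proof.
move=> p_pr m_gt0; have p_gt1 := prime_gt1 p_pr; set t := trunc_log p (m + m).
have mm_gt0 : 0 < m + m by rewrite addn_gt0 m_gt0.
apply: leq_trans (trunc_logP p_gt1 mm_gt0); rewrite leq_exp2l // -/t.
rewrite -(leq_add2r (logn p m`!).*2) -logn_central_bin.
rewrite logn_fact // (logn_fact_widen _ _ _ p_pr (leq_addl m m)).
apply: leq_trans (_ : \sum_(1 <= k < (m + m).+1) ((k <= t) + (m %/ p ^ k).*2) <= _).
  apply: leq_sum => k _; have pk_gt0 : 0 < p ^ k by rewrite expn_gt0 ltnW.
  have [le_kt | lt_tk] := leqP k t.
    rewrite -ltnS ltn_divLR //.
    have := ltn_pmod m pk_gt0; have := divn_eq m (p ^ k); lia.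
  rewrite divn_small //; apply: leq_trans (trunc_log_ltn _ p_gt1) _.
  by rewrite leq_exp2l.
rewrite big_split /= -(big_morph _ doubleD double0) leq_add2r.
(* At most t of the indices k >= 1 satisfy k <= t, whatever the length of the range. *)
elim: (m + m) => [|M IHM]; first by rewrite big_nil.
have [le_tM | lt_Mt] := leqP t M.
  by rewrite big_nat_recr //= [M < t]ltnNge le_tM addn0.
apply: leq_trans lt_Mt; apply: leq_trans (_ : \sum_(1 <= k < M.+2) 1 <= _).
  by apply: leq_sum => k _; apply: leq_b1.
by rewrite sum_nat_const_nat muln1 subn1.
Qed.

Lemma logn_central_bin_big p m : m + m < p -> logn p 'C(m + m, m) = 0.
Proof.
move=> lt_mp; have [p_pr | p_npr] := boolP (prime p); last by rewrite lognE (negbTE p_npr).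
apply/eqP; rewrite -leqn0 -(leq_add2r (logn p m`!).*2) -logn_central_bin.
by rewrite logn_fact_small.
Qed.

Lemma logn_central_bin_gt0 p m : prime p -> m < p <= m + m -> 0 < logn p 'C(m + m, m).
Proof.
move=> p_pr /andP[lt_mp le_pm].
have : 0 < logn p (m + m)`!.
  by rewrite logn_gt0 mem_primes p_pr fact_gt0 dvdn_fact // prime_gt0.
by rewrite logn_central_bin (logn_fact_small p m) // addn0.
Qed.

Lemma central_bin_prod m : 'C(m + m, m) =
  \prod_(p <- iota 0 (m + m).+1 | prime p) p ^ logn p 'C(m + m, m).
Proof.
by apply: prod_pfactor; rewrite ?bin_gt0 ?leq_addl // => p; apply: logn_central_bin_big.
Qed.

Lemma prod_nat_const_seq (I : Type) (s : seq I) (P : pred I) c :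
  \prod_(i <- s | P i) c = c ^ count P s.
Proof. by rewrite big_const_seq iter_muln_1. Qed.

Lemma central_bin_leq m : 0 < m -> 'C(m + m, m) <= (m + m) ^ prime_count (m + m).
Proof.
move=> m_gt0; rewrite central_bin_prod -prod_nat_const_seq.
by apply: leq_prod => p p_pr; apply: pfactor_central_bin.
Qed.

(** Every prime in (m, 2m] divides (2m)! but not m!, hence divides the binomial, and exceeds m. *)
Lemma exp_prime_count_leq m : m ^ (count prime (iota m.+1 m)) <= 'C(m + m, m).
Proof.
rewrite [leqRHS]central_bin_prod -addSn iotaD big_cat /=.
rewrite -[leqLHS]mul1n leq_mul //.
  by rewrite big_seq_cond prodn_cond_gt0 // => p _; rewrite pfactor_gt0.
rewrite -prod_nat_const_seq big_seq_cond [leqRHS]big_seq_cond.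
apply: leq_prod => p /andP[]; rewrite mem_iota => /andP[lt_mp le_pm] p_pr.
apply: leq_trans (ltnW lt_mp) _; rewrite -{1}[p]expn1 leq_exp2l ?prime_gt1 //.
by rewrite logn_central_bin_gt0 // lt_mp.
Qed.

(** Let c be the number of primes in (2^k, 2^(k+1)]; the central binomial gives k c <= 2 * 2^k.
    Multiplying the count up to 2^(k+1) by k + 1 then gives at most (4 + 2 + 2) * 2^k, the last 2
    from the trivial bound on one copy of that count. *)
Lemma prime_count_exp2_leq k : k * prime_count (2 ^ k) <= 4 * 2 ^ k.
Proof.
elim: k => // k IHk; have def2 : 2 ^ k.+1 = 2 ^ k + 2 ^ k by rewrite expnS mul2n addnn.
have : 2 ^ (k * count prime (iota (2 ^ k).+1 (2 ^ k))) <= 2 ^ (2 ^ k + 2 ^ k).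
  by rewrite expnM (leq_trans (exp_prime_count_leq _)) // bin_leq_exp2.
rewrite leq_exp2l // => le_c; have := prime_count_leq (2 ^ k.+1).
rewrite !def2; have := prime_countD (2 ^ k) (2 ^ k); nia.
Qed.

(** With m = 2^k, compare the exponents of 2 in 2^m <= 'C(2m, m) <= (2m)^pi(2m), where pi counts
    primes. *)
Lemma prime_count_exp2_geq k : 2 ^ k <= k.+1 * prime_count (2 ^ k.+1).
Proof.
have def2 : 2 ^ k.+1 = 2 ^ k + 2 ^ k by rewrite expnS mul2n addnn.
rewrite -(@leq_exp2l 2) // expnM def2.
by rewrite (leq_trans (central_bin_geq _)) // -def2 def2 central_bin_leq // expn_gt0.
Qed.

(** * Bounds for the n-th prime *)

Lemma log_nth_prime_leq n : 0 < n -> (trunc_log 2 (nth_prime n)).+1 * n <= 8 * nth_prime n.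
Proof.
move=> n_gt0; have p_pr := prime_nth_prime n_gt0.
have := count_nth_prime n; rewrite -/(prime_count _).
move: (nth_prime n) p_pr => p p_pr def_n; set l := trunc_log 2 p.
have le_lp : 2 ^ l <= p by rewrite trunc_logP // prime_gt0.
have le_n : n <= prime_count (2 ^ l.+1).
  by rewrite -def_n leq_prime_count // ltnW // trunc_log_ltn.
apply: leq_trans (leq_mul (leqnn _) le_n) _.
apply: leq_trans (prime_count_exp2_leq _) _.
by rewrite expnS mulnA leq_mul2l.
Qed.

(** The factor 2 accommodates l = 3. *)
Lemma sqr_leq_exp2 l : l ^ 2 <= 2 * 2 ^ l.
Proof.
have [|] := ltnP l 4; first by case: l => [|[|[|[|]]]].
move=> /subnKC <-; elim: (l - 4) => // k IH.
by move: IH; rewrite addnS -!mulnn (expnS 2); nia.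
Qed.

(** Chebyshev's lower bound gives p < 4 l n with l the logarithm of p itself; a cruder bound, p of
    order at most n^2, then replaces l by the logarithm of n. *)
Lemma nth_prime_leq n : 0 < n -> nth_prime n <= 4 * n * (2 * trunc_log 2 n + 7).
Proof.
move=> n_gt0; have p_pr := prime_nth_prime n_gt0.
have := count_nth_prime n; rewrite -/(prime_count _).
move: (nth_prime n) p_pr => p p_pr def_n; set l := trunc_log 2 p.
have p_gt0 := prime_gt0 p_pr.
have le_lp : 2 ^ l <= p by rewrite trunc_logP.
have lt_pl : p < 2 ^ l.+1 by rewrite trunc_log_ltn.
have l_gt0 : 0 < l by rewrite trunc_log_gt0 /= prime_gt1.
have le_n : 2 ^ l <= 2 * (l * n).
  rewrite -(prednK l_gt0) expnS leq_mul2l /=.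
  apply: leq_trans (prime_count_exp2_geq _) _; rewrite prednK //.
  by apply: leq_mul; rewrite // -def_n leq_prime_count.
(* Squaring [le_n] and using l^2 <= 2 * 2^l leaves one factor 2^l to cancel. *)
have le_n2 : 2 ^ l <= 8 * n ^ 2.
  rewrite -(@leq_pmul2l (2 ^ l)) ?expn_gt0 //.
  apply: leq_trans (leq_mul le_n le_n) _; have := sqr_leq_exp2 l; nia.
have lt_n : n < 2 ^ (trunc_log 2 n).+1 by rewrite trunc_log_ltn.
(* The 7 leaves room for 3 from the factor 8 and 2 from rounding the logarithm of n. *)
have le_l : l <= 2 * trunc_log 2 n + 7.
  rewrite -(@leq_exp2l 2) //; apply: leq_trans le_n2 _.
  rewrite (_ : 2 * trunc_log 2 n + 7 = (trunc_log 2 n).+1 * 2 + 5); last lia.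
  by rewrite expnD expnM mulnC leq_mul // leq_exp2r // ltnW.
apply: leq_trans (ltnW lt_pl) _; rewrite expnS.
apply: leq_trans (leq_mul (leqnn 2) le_n) _; rewrite !mulnA.
by rewrite mulnAC leq_mul.
Qed.

(** * Comparison of the n-th prime with the sum of the heights *)

Lemma height_sum_leq_nth_prime n : 0 < n -> height_sum n <= 8 * nth_prime n.
Proof.
move=> n_gt0; apply: leq_trans (height_sum_leq n) _.
apply: leq_trans (log_nth_prime_leq n n_gt0).
rewrite mulnC leq_mul // ltnS leq_trunc_log //.
by rewrite -{1}(count_nth_prime n) prime_count_leq.
Qed.

Lemma nth_prime_leq_height_sum n :
  0 < n -> nth_prime n <= 32 * height_sum n + 36 * n.
Proof.
move=> n_gt0; apply: leq_trans (nth_prime_leq n n_gt0) _.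
(* With L the logarithm of n and S the sum: 4 n (2 L + 7) = 8 n L + 28 n <= 8 (4 S + n) + 28 n. *)
have := height_sum_geq n; nia.
Qed.

Local Open Scope ring_scope.

Theorem theorem4p4 (R : realType) :
  exists a A1 A2 : R,
    [/\ 0 < a, 0 < A1, 0 < A2 &
      forall n : nat, (2 < n)%N ->
        a * (height_sum n)%:R <= (nth_prime n)%:R
          <= A1 * (height_sum n)%:R + A2 * n%:R].
Proof.
exists (8%:R^-1), 32%:R, 36%:R; split; rewrite ?invr_gt0 ?ltr0n // => n n_gt2.
have n_gt0 : (0 < n)%N by apply: leq_trans n_gt2.
rewrite ler_pdivrMl ?ltr0n // -!natrM -natrD !ler_nat.
by rewrite height_sum_leq_nth_prime ?nth_prime_leq_height_sum.
Qed.
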